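(* For every real number $\lambda>1$ there exists a periodic packing $\mathcal{C}$ of the plane $\mathbb{R}^2$ with ellipses whose $\lambda$-enlargement is a covering of the plane, i.e. $\bigcup_{C\in\mathcal{C}} C^{(\lambda)}=\mathbb{R}^2$, where $C^{(\lambda)}$ denotes the ellipse $C$ enlarged by the factor $\lambda$ from its center.
   Context: An ellipse is understood as a solid region: the image of the closed unit disc in $\mathbb{R}^2$ under an invertible affine map. A packing is a system $\mathcal{C}$ (finite or infinite) of centrally symmetric convex bodies (compact convex sets with nonempty interior) whose interiors are pairwise disjoint. For a centrally symmetric convex body $C$ with center of symmetry $c$, and $\lambda>1$, put $C^{(\lambda)}=\lambda(C-c)+c$. The $\lambda$-enlargement of a packing $\mathcal{C}$ is the system $\{C^{(\lambda)} : C\in\mathcal{C}\}$; it is a covering if the union of its members is the whole plane. A system $\mathcal{C}$ of sets in the plane is periodic if there are two linearly independent vectors $u_1,u_2\in\mathbb{R}^2$ such that $C+u_1, C-u_1, C+u_2, C-u_2\in\mathcal{C}$ for every $C\in\mathcal{C}$. *)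

(* Defs.v *)
From mathcomp Require Import all_boot all_order all_algebra.
From mathcomp Require Import all_classical all_reals all_analysis.

Set Implicit Arguments.
Unset Strict Implicit.
Unset Printing Implicit Defensive.

Import Order.TTheory GRing.Theory Num.Theory.
Import numFieldNormedType.Exports.

Local Open Scope classical_set_scope.
Local Open Scope ring_scope.

Section Packings.
Variable R : realType.

Local Notation plane := 'rV[R]_2.

(* The library's norm on row vectors is the sup norm: it yields the usual
   topology, but its unit ball is a square, not the Euclidean disc. *)
Definition unit_disc : set plane :=
  [set x : plane | x 0 0 ^+ 2 + x 0 1 ^+ 2 <= 1].

Definition is_ellipse (C : set plane) : Prop :=
  exists (A : 'M[R]_2) (b : plane),
    A \in unitmx /\ C = [set x *m A + b | x in unit_disc].

Definition is_symmetry_center (C : set plane) (c : plane) : Prop :=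
  forall x, C x -> C (c *+ 2 - x).

Definition is_symmetric_convex_body (C : set plane) : Prop :=
  [/\ compact C, convex_set C, C° !=set0 &
      exists c, is_symmetry_center C c].

(* A nonempty bounded set has at most one center of symmetry, so for a
   centrally symmetric convex body the choice made here is forced. *)
Definition symmetry_center (C : set plane) : plane :=
  get (is_symmetry_center C).

Definition enlarge (lambda : R) (C : set plane) : set plane :=
  [set lambda *: (x - symmetry_center C) + symmetry_center C | x in C].

Definition enlargement (lambda : R) (CC : set (set plane)) : set (set plane) :=
  [set enlarge lambda C | C in CC].

Definition is_packing (CC : set (set plane)) : Prop :=
  (forall C, CC C -> is_symmetric_convex_body C) /\
  trivIset CC (fun C => C°).

Definition is_covering (CC : set (set plane)) : Prop :=
  \bigcup_(C in CC) C = [set: plane].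

Definition translate (C : set plane) (u : plane) : set plane :=
  [set x + u | x in C].

Definition is_periodic (CC : set (set plane)) : Prop :=
  exists u1 u2 : plane, free [:: u1; u2] /\
    forall C, CC C ->
      [/\ CC (translate C u1), CC (translate C (- u1)),
          CC (translate C u2) & CC (translate C (- u2))].

End Packings.

(* Main.v *)
Require Import Defs.
From mathcomp Require Import all_boot all_order all_algebra.
From mathcomp Require Import all_classical all_reals all_analysis.
From mathcomp Require Import ring lra zify.

(** Unit discs centred at (2i, 4j) leave gaps that are cut into narrow vertical
    rectangles; the enlarged discs cover a neighbourhood of the two horizontal
    ends of every rectangle.  So it suffices to pack ellipses into a rectangle
    so that their enlargements cover it up to thin strips at the bottom and at
    the top.

    Start with the inscribed ellipse; the vertical walls count as degenerate
    ellipses.  What remains are gaps between a left body L and a right body M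
    that touch at some height, standing on the line y = 0.  If L and M touch at
    height t + 1, insert the ellipse N that touches L and M at points of height
    t and is tangent to y = 0.  The part of the gap between the heights t and
    t + 1 is divided by the common tangent of L and M at height t + 1 into a
    part covered by the enlarged L and a part covered by the enlarged M, as soon
    as t is large compared with 1 / (lambda^2 - 1).  Iterating over the two new
    gaps (L, N) and (N, M) lowers the uncovered part by 1 each time.  The point
    is that the steps do not degenerate: N rises above the height t by at least
    1/9, because the tangents of L and M at height t meet at least 1/3 above
    it. *)

Import Order.TTheory GRing.Theory Num.Theory.
Import numFieldNormedType.Exports.
Local Open Scope classical_set_scope.
Local Open Scope ring_scope.

Set Implicit Arguments.
Unset Strict Implicit.
Unset Printing Implicit Defensive.

(* Half-height hh, horizontal half-width hw at the level of the centre (cx, cy),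
   sheared horizontally with slope sh.  hw and hh may be negative, so that point
   reflections act on the parameters. *)
Record ellipse (R : realType) := Ellipse { cx : R; cy : R; sh : R; hw : R; hh : R }.

Definition gauge2 (R : realType) (e : ellipse R) (x y : R) : R :=
  ((x - cx e - sh e * (y - cy e)) / hw e) ^+ 2 + ((y - cy e) / hh e) ^+ 2.

(* An arc of the ellipse of height sH standing on y = 0 at the point (sc, 0),
   namely x = sc + sk y + sb sqrt(y (sH - y)): the right-hand arc if sb > 0, the
   left-hand one if sb < 0, and a straight wall if sb = 0. *)
Record side (R : realType) := Side { sc : R; sk : R; sb : R; sH : R }.

(** * Arcs of ellipses standing on y = 0 and their tangents *)

Section Conic.
Variable R : realType.
Implicit Types (s L N : side R) (x y t : R).

Definition bdry s y := sc s + sk s * y + sb s * Num.sqrt (y * (sH s - y)).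

Definition slope s t := sk s + sb s * (sH s - 2 * t) / (2 * Num.sqrt (t * (sH s - t))).

Definition tangent_at s t y := bdry s t + slope s t * (y - t).

(** The other arc of the same ellipse. Its [ellipse_of] is a different record, with [hw] negated,
    but has the same [gauge2]. *)
Definition opp_side s := Side (sc s) (sk s) (- sb s) (sH s).

Definition ellipse_of s :=
  Ellipse (sc s + sk s * (sH s / 2)) (sH s / 2) (sk s) (sb s * sH s / 2) (sH s / 2).

(** The polar form of the tangent: since sqrt (t (H - t)) squares to t (H - t), value and slope
    merge into one fraction whose numerator is symmetric in y and t. *)
Lemma tangent_atE s t y : 0 < t < sH s ->
  tangent_at s t y = sc s + sk s * y +
    sb s * ((sH s * (y + t) - 2 * y * t) / (2 * Num.sqrt (t * (sH s - t)))).
Proof.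
move=> /andP[t0 tH]; rewrite /tangent_at /bdry /slope.
have r0 : 0 < t * (sH s - t) by rewrite mulr_gt0 // subr_gt0.
have q0 : 0 < Num.sqrt (t * (sH s - t)) by rewrite sqrtr_gt0.
have qE : Num.sqrt (t * (sH s - t)) ^+ 2 = t * (sH s - t) by rewrite sqr_sqrtr // ltW.
move: (Num.sqrt _) q0 qE => q q0 qE.
have -> : sH s * (y + t) - 2 * y * t = 2 * q ^+ 2 + (sH s - 2 * t) * (y - t).
  by rewrite qE; ring.
by field; rewrite gt_eqF.
Qed.

(** With p and q the two square roots, H (y + t) - 2 y t - 2 p q = (p - q)^2 + (y - t)^2. *)
Lemma sqrt_tangent_ge (H t y : R) : 0 < t < H -> 0 <= y <= H ->
  Num.sqrt (y * (H - y)) <= (H * (y + t) - 2 * y * t) / (2 * Num.sqrt (t * (H - t))).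
Proof.
move=> /andP[t0 tH] /andP[y0 yH].
have r0 : 0 < t * (H - t) by rewrite mulr_gt0 // subr_gt0.
have q0 : 0 < Num.sqrt (t * (H - t)) by rewrite sqrtr_gt0.
have qE : Num.sqrt (t * (H - t)) ^+ 2 = t * (H - t) by rewrite sqr_sqrtr // ltW.
have r1 : 0 <= y * (H - y) by rewrite mulr_ge0 // subr_ge0.
have pE := sqr_sqrtr r1.
rewrite ler_pdivlMr; last by rewrite mulr_gt0.
have := sqr_ge0 (Num.sqrt (y * (H - y)) - Num.sqrt (t * (H - t))).
have := sqr_ge0 (y - t).
move: (Num.sqrt (y * _)) (Num.sqrt (t * _)) pE qE => p q pE qE.
nra.
Qed.

Lemma bdry_le_tangent s t y : 0 <= sb s -> 0 < t < sH s -> 0 <= y <= sH s ->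
  bdry s y <= tangent_at s t y.
Proof.
by move=> b0 tH yH; rewrite tangent_atE // lerD2l ler_wpM2l // sqrt_tangent_ge.
Qed.

Lemma tangent_le_bdry s t y : sb s <= 0 -> 0 < t < sH s -> 0 <= y <= sH s ->
  tangent_at s t y <= bdry s y.
Proof.
by move=> b0 tH yH; rewrite tangent_atE // lerD2l ler_wnM2l // sqrt_tangent_ge.
Qed.

(* With s_t = sqrt (t (H - t)): the tangents at the levels u and v meet at the
   vertical distance (v - u) s_u / (s_u + s_v) above the level u. *)
Lemma tangent_ratio s (u v : R) : 0 < u < sH s -> 0 < v < sH s ->
  (tangent_at s v u - bdry s u) * (Num.sqrt (v * (sH s - v)) + Num.sqrt (u * (sH s - u))) =
  (v - u) * (slope s u - slope s v) * Num.sqrt (u * (sH s - u)).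
Proof.
move=> /andP[u0 uH] /andP[v0 vH].
have ru : 0 < u * (sH s - u) by rewrite mulr_gt0 // subr_gt0.
have rv : 0 < v * (sH s - v) by rewrite mulr_gt0 // subr_gt0.
rewrite tangent_atE ?v0 // /bdry /slope.
have p0 : 0 < Num.sqrt (u * (sH s - u)) by rewrite sqrtr_gt0.
have q0 : 0 < Num.sqrt (v * (sH s - v)) by rewrite sqrtr_gt0.
have pE := sqr_sqrtr (ltW ru). have qE := sqr_sqrtr (ltW rv).
move: (Num.sqrt (u * _)) (Num.sqrt (v * _)) p0 q0 pE qE => p q p0 q0 pE qE.
have pn : p != 0 by rewrite gt_eqF.
have qn : q != 0 by rewrite gt_eqF.
apply: (mulfI (x := 2 * q)); first by rewrite mulf_neq0 // pnatr_eq0.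
have -> : 2 * q * ((sc s + sk s * u + sb s * ((sH s * (u + v) - 2 * u * v) / (2 * q)) -
    (sc s + sk s * u + sb s * p)) * (q + p)) =
  sb s * (sH s * (u + v) - 2 * u * v - 2 * p * q) * (q + p) by field.
have -> : 2 * q * ((v - u) * (sk s + sb s * (sH s - 2 * u) / (2 * p) -
     (sk s + sb s * (sH s - 2 * v) / (2 * q))) * p) =
   sb s * (v - u) * ((sH s - 2 * u) * q - (sH s - 2 * v) * p).
  by field; rewrite qn.
rewrite -mulrA -[RHS]mulrA; congr (_ * _).
have -> : sH s * (u + v) - 2 * u * v - 2 * p * q = (p - q) ^+ 2 + (v - u) ^+ 2.
  rewrite sqrrB pE qE; ring.
have E : (q - p) * (q + p) = (v - u) * (sH s - u - v).
  by rewrite -subr_sqr pE qE; ring.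
transitivity ((q - p) * ((q - p) * (q + p)) + (v - u) ^+ 2 * (q + p)); first by ring.
rewrite E; ring.
Qed.

Lemma gauge2_ellipse_of s x y : sb s != 0 -> sH s != 0 ->
  gauge2 (ellipse_of s) x y =
  1 + 4 * ((x - sc s - sk s * y) ^+ 2 - sb s ^+ 2 * (y * (sH s - y))) / (sb s * sH s) ^+ 2.
Proof.
by move=> b0 H0; rewrite /gauge2 /ellipse_of /=; field; rewrite ?b0 ?H0.
Qed.

Lemma ellipse_of_lt1 s x y : 0 < sb s -> 0 < sH s ->
  gauge2 (ellipse_of s) x y < 1 ->
  0 < y < sH s /\ bdry (opp_side s) y < x < bdry s y.
Proof.
move=> b0 H0; rewrite gauge2_ellipse_of ?gt_eqF // -[X in _ < X]addr0 ltrD2l.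
rewrite pmulr_llt0 ?invr_gt0 ?exprn_gt0 ?mulr_gt0 // pmulr_rlt0 // subr_lt0 => h.
have r0 : 0 < y * (sH s - y).
  by rewrite -(pmulr_rgt0 _ (exprn_gt0 2 b0)) (le_lt_trans _ h) // sqr_ge0.
have yH : 0 < y < sH s.
  by apply/andP; split; nra.
split=> //; have : `|x - sc s - sk s * y| < sb s * Num.sqrt (y * (sH s - y)).
  rewrite -(ltr_pXn2r (n := 2)) // ?nnegrE ?mulr_ge0 ?sqrtr_ge0 ?(ltW b0) //.
  by rewrite real_normK ?num_real // exprMn sqr_sqrtr // ltW.
by rewrite ltr_norml /bdry /= => /andP[h1 h2]; apply/andP; split; lra.
Qed.

Lemma ellipse_of_le1 s x y : 0 < sb s -> 0 < sH s -> 0 <= y <= sH s ->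
  bdry (opp_side s) y <= x <= bdry s y -> gauge2 (ellipse_of s) x y <= 1.
Proof.
move=> b0 H0 /andP[y0 yH] hx; rewrite gauge2_ellipse_of ?gt_eqF //.
rewrite -[X in _ <= X]addr0 lerD2l pmulr_lle0 ?invr_gt0 ?exprn_gt0 ?mulr_gt0 //.
rewrite pmulr_rle0 // subr_le0.
have r0 : 0 <= y * (sH s - y) by rewrite mulr_ge0 // subr_ge0.
have h : `|x - sc s - sk s * y| <= sb s * Num.sqrt (y * (sH s - y)).
  by move: hx; rewrite ler_norml /bdry /= => /andP[h1 h2]; apply/andP; split; lra.
have : `|x - sc s - sk s * y| ^+ 2 <= (sb s * Num.sqrt (y * (sH s - y))) ^+ 2.
  by rewrite ler_pXn2r // ?nnegrE // mulr_ge0 ?sqrtr_ge0 // ltW.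
by rewrite real_normK ?num_real // exprMn sqr_sqrtr.
Qed.

(** For a wall [hw] is 0, and division by 0 gives 0, so [gauge2] would ignore the horizontal offset;
    the first condition keeps walls from covering anything. *)
Definition side_covers (lam : R) s x y :=
  sb s != 0 /\ gauge2 (ellipse_of s) x y <= lam ^+ 2.

Lemma side_covers_opp lam s x y : side_covers lam (opp_side s) x y <-> side_covers lam s x y.
Proof.
have E : gauge2 (ellipse_of (opp_side s)) x y = gauge2 (ellipse_of s) x y.
  by rewrite /gauge2 /ellipse_of /= mulNr mulNr invrN mulrN sqrrN.
by rewrite /side_covers E /= oppr_eq0.
Qed.

(* The conic and its tangent at height t differ, in the square of the
   half-width, by b^2 H^2 (y - t)^2 / (4 t (H - t)). *)
Lemma side_covers_to_tangent (lam : R) s t x y : 0 < sb s -> 0 < t < sH s -> 0 <= y <= sH s ->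
  (y - t) ^+ 2 <= (lam ^+ 2 - 1) * (t * (sH s - t)) ->
  bdry s y <= x <= tangent_at s t y -> side_covers lam s x y.
Proof.
move=> b0 /andP[t0 tH] /andP[y0 yH] hd /andP[hx1 hx2].
have H0 : 0 < sH s by lra.
have r0 : 0 < t * (sH s - t) by rewrite mulr_gt0 // subr_gt0.
split; first by rewrite gt_eqF.
rewrite gauge2_ellipse_of ?gt_eqF // -lerBrDl ler_pdivrMr ?exprn_gt0 ?mulr_gt0 //.
move: hx2; rewrite tangent_atE ?t0 // => hx2.
set X := x - sc s - sk s * y.
have X0 : 0 <= X.
  move: hx1; rewrite /bdry /X => h.
  have : 0 <= sb s * Num.sqrt (y * (sH s - y)) by rewrite mulr_ge0 ?sqrtr_ge0 ?ltW.
  by lra.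
set P := sH s * (y + t) - 2 * y * t in hx2.
have q0 : 0 < Num.sqrt (t * (sH s - t)) by rewrite sqrtr_gt0.
have qE : Num.sqrt (t * (sH s - t)) ^+ 2 = t * (sH s - t) by rewrite sqr_sqrtr // ltW.
move: (Num.sqrt _) q0 qE hx2 => q q0 qE hx2.
have XP : 2 * q * X <= sb s * P.
  have : X <= sb s * (P / (2 * q)) by rewrite /X; lra.
  by rewrite mulrA ler_pdivlMr ?mulr_gt0 // mulrC.
have XP2 : 4 * (t * (sH s - t)) * X ^+ 2 <= sb s ^+ 2 * P ^+ 2.
  have h : (2 * q * X) ^+ 2 <= (sb s * P) ^+ 2.
    rewrite ler_pXn2r // ?nnegrE; first by rewrite mulr_ge0 // mulr_ge0 // ltW.
    by apply: le_trans XP; rewrite mulr_ge0 // mulr_ge0 // ltW.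
  rewrite -qE -exprMn; apply: le_trans h.
  by rewrite le_eqVlt; apply/orP; left; apply/eqP; ring.
rewrite -(ler_pM2l r0).
have -> : t * (sH s - t) * (4 * (X ^+ 2 - sb s ^+ 2 * (y * (sH s - y)))) =
  4 * (t * (sH s - t)) * X ^+ 2 - 4 * (t * (sH s - t)) * (sb s ^+ 2 * (y * (sH s - y))).
  by ring.
have E : P ^+ 2 = 4 * (t * (sH s - t)) * (y * (sH s - y)) + sH s ^+ 2 * (y - t) ^+ 2.
  by rewrite /P; ring.
have h2 : (sb s * sH s) ^+ 2 * (y - t) ^+ 2 <=
   (sb s * sH s) ^+ 2 * ((lam ^+ 2 - 1) * (t * (sH s - t))).
  by rewrite ler_wpM2l // sqr_ge0.
rewrite E in XP2; move: XP2 h2.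
rewrite !exprMn; set a := sb s ^+ 2; set c := sH s ^+ 2; set d := (y - t) ^+ 2.
set l := lam ^+ 2; set m := t * (sH s - t); set n := y * (sH s - y).
by move=> A B; lra.
Qed.

(** The lines through [pL] and [pR] at height t with slopes [kL] and [kR] meet at height t + f,
    where f = (pR - pL) / (kL - kR). The last two hypotheses say 1/3 <= f <= 1. *)
Lemma conic_in_wedge (t pL kL pR kR : R) : 1 <= t -> 0 < pR - pL ->
  kL - kR <= 3 * (pR - pL) -> pR - pL <= kL - kR ->
  exists N : side R, [/\ 0 < sb N, t + 1 / 9 <= sH N < t + 1,
    bdry (opp_side N) t = pL /\ slope (opp_side N) t = kL &
    bdry N t = pR /\ slope N t = kR].
Proof.
move=> t1 g0 h1 h2.
have t0 : 0 < t by lra.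
have c0 : 0 < kL - kR by lra.
pose f := (pR - pL) / (kL - kR).
have fg : f * (kL - kR) = pR - pL by rewrite /f divfK // gt_eqF.
have f1 : f <= 1 by rewrite /f ler_pdivrMr // mul1r.
have f3 : 1 / 3 <= f by rewrite /f ler_pdivlMr //; lra.
(* The wedge has its apex at height t + f, and t is at distance f from the apex;
   f is then the harmonic mean of the distances t + f and t + f - H of the
   bottom and the top of the ellipse from the apex. *)
pose H := 2 * t * (t + f) / (2 * t + f).
have tf0 : 0 < 2 * t + f by lra.
have HE : H * (2 * t + f) = 2 * t * (t + f) by rewrite /H divfK // gt_eqF.
have Ht : H - t = t * f / (2 * t + f).
  by rewrite /H; field; rewrite gt_eqF.
(* t f / (2 t + f) grows with t and with f, so it is at least 1/7, its value at t = 1, f = 1/3. *)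
have Hlo : 1 / 9 <= H - t.
  by rewrite Ht ler_pdivlMr //; nra.
have Hhi : H - t < 1.
  by rewrite Ht ltr_pdivrMr //; nra.
have r0 : 0 < t * (H - t) by rewrite mulr_gt0 //; lra.
have q0 : 0 < Num.sqrt (t * (H - t)) by rewrite sqrtr_gt0.
have qE : Num.sqrt (t * (H - t)) ^+ 2 = t * (H - t) by rewrite sqr_sqrtr // ltW.
(* Shearing by the mean slope makes the wedge symmetric, and [b] fits the chord at height t; the
   choice of [H] then makes the slopes agree. *)
pose k := (kL + kR) / 2.
pose b := (pR - pL) / (2 * Num.sqrt (t * (H - t))).
exists (Side ((pL + pR) / 2 - k * t) k b H).
rewrite /bdry /slope /opp_side /=.
have b0 : 0 < b by rewrite /b divr_gt0 // mulr_gt0.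
have bq : b * Num.sqrt (t * (H - t)) = (pR - pL) / 2.
  by rewrite /b; field; rewrite gt_eqF.
have bs : b * (H - 2 * t) / (2 * Num.sqrt (t * (H - t))) = (kR - kL) / 2.
  have -> : b * (H - 2 * t) / (2 * Num.sqrt (t * (H - t))) =
     (pR - pL) * (H - 2 * t) / (4 * Num.sqrt (t * (H - t)) ^+ 2).
    by rewrite /b; field; rewrite gt_eqF.
  rewrite qE -fg.
  have n0 : 4 * (t * (H - t)) != 0 by rewrite gt_eqF // mulr_gt0.
  apply: (mulIf n0); rewrite divfK //.
  transitivity ((kL - kR) * (H * (2 * t + f) - 2 * t * H - 2 * t * f)); first by ring.
  by rewrite HE; field.
split=> //.
- by apply/andP; split; lra.
- by split; rewrite ?mulNr ?bq ?bs /k; field.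
- by split; rewrite ?bq ?bs /k; field.
Qed.

(** Let p and q be the square roots at the levels t and t + 1. By [tangent_ratio] the difference of
    slopes is (p + q) / p times the horizontal distance, and q <= 2 p puts this factor between 1 and
    3. This is the source of the height 1/3 of the wedge. *)
Lemma tangent_ratio_bound s t : 0 <= sb s -> 1 <= t -> t + 1 < sH s ->
  [/\ 0 <= tangent_at s (t + 1) t - bdry s t,
      0 < sb s -> 0 < tangent_at s (t + 1) t - bdry s t,
      slope s t - slope s (t + 1) <= 3 * (tangent_at s (t + 1) t - bdry s t) &
      tangent_at s (t + 1) t - bdry s t <= slope s t - slope s (t + 1)].
Proof.
move=> b0 t1 tH.
have iu : 0 < t < sH s by apply/andP; split; lra.
have iv : 0 < t + 1 < sH s by apply/andP; split; lra.
have := @tangent_ratio s t (t + 1) iu iv.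
have ru : 0 < t * (sH s - t) by rewrite mulr_gt0 //; lra.
have rv : 0 < (t + 1) * (sH s - (t + 1)) by rewrite mulr_gt0 //; lra.
have p0 : 0 < Num.sqrt (t * (sH s - t)) by rewrite sqrtr_gt0.
have q0 : 0 < Num.sqrt ((t + 1) * (sH s - (t + 1))) by rewrite sqrtr_gt0.
have pE := sqr_sqrtr (ltW ru). have qE := sqr_sqrtr (ltW rv).
have DE : tangent_at s (t + 1) t - bdry s t = sb s * (((Num.sqrt ((t + 1) * (sH s - (t + 1))) -
    Num.sqrt (t * (sH s - t))) ^+ 2 + 1) / (2 * Num.sqrt ((t + 1) * (sH s - (t + 1))))).
  rewrite tangent_atE // /bdry.
  have -> : (Num.sqrt ((t + 1) * (sH s - (t + 1))) - Num.sqrt (t * (sH s - t))) ^+ 2 + 1 =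
     (sH s * (t + (t + 1)) - 2 * t * (t + 1)) -
     2 * Num.sqrt ((t + 1) * (sH s - (t + 1))) * Num.sqrt (t * (sH s - t)).
    by rewrite sqrrB pE qE; ring.
  by field; rewrite gt_eqF.
have D0 : 0 <= tangent_at s (t + 1) t - bdry s t.
  by rewrite DE mulr_ge0 // divr_ge0 ?addr_ge0 ?sqr_ge0 ?mulr_ge0 ?(ltW q0).
rewrite (_ : t + 1 - t = 1) ?mul1r; last by ring.
move=> E.
(* From t + 1 <= 2 t and H - (t + 1) <= H - t. *)
have hpq : Num.sqrt ((t + 1) * (sH s - (t + 1))) <= 2 * Num.sqrt (t * (sH s - t)).
  rewrite -(ler_pXn2r (n := 2)) // ?nnegrE ?mulr_ge0 ?(ltW p0) ?(ltW q0) //.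
  by rewrite exprMn pE qE; nra.
split=> //.
- by move=> b1; rewrite DE mulr_gt0 // divr_gt0 ?mulr_gt0 // ltr_wpDl // sqr_ge0.
- by move: (Num.sqrt _) (Num.sqrt _) p0 q0 hpq E D0 => p q *; nra.
- by move: (Num.sqrt _) (Num.sqrt _) p0 q0 hpq E D0 => p q *; nra.
Qed.
End Conic.

(** * Recursive filling of the gap between two touching bodies *)

Section Gap.
Variable R : realType.
Implicit Types (s L N : side R) (x y t : R).

(** The reflection x -> -x; it turns a right body of a gap into a left one, so that estimates for
    [sb] >= 0 apply to it. *)
Definition mirror_side s := Side (- sc s) (- sk s) (- sb s) (sH s).

Lemma bdry_mirror s y : bdry (mirror_side s) y = - bdry s y.
Proof. by rewrite /bdry /=; ring. Qed.

Lemma slope_mirror s t : slope (mirror_side s) t = - slope s t.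
Proof. by rewrite /slope /=; rewrite !mulNr; ring. Qed.

Lemma tangent_mirror s t y : tangent_at (mirror_side s) t y = - tangent_at s t y.
Proof. by rewrite /tangent_at bdry_mirror slope_mirror; ring. Qed.

Lemma side_covers_mirror lam s x y :
  side_covers lam (mirror_side s) (- x) y <-> side_covers lam s x y.
Proof.
rewrite /side_covers /= oppr_eq0.
suff -> : gauge2 (ellipse_of (mirror_side s)) (- x) y = gauge2 (ellipse_of s) x y by [].
rewrite /gauge2 /ellipse_of /=; congr (_ + _).
have -> : - sb s * sH s / 2 = - (sb s * sH s / 2) by ring.
by rewrite invrN mulrN -mulNr; congr ((_ * _) ^+ 2); ring.
Qed.

(* {gauge2 e < 1} is the interior of the ellipse e. *)
Definition packs (S : set (ellipse R)) (D : R -> R -> Prop) :=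
  [/\ forall e, S e -> hw e != 0 /\ hh e != 0,
      forall e x y, S e -> gauge2 e x y < 1 -> D x y &
      forall e e' x y, S e -> S e' -> gauge2 e x y < 1 -> gauge2 e' x y < 1 -> e = e'].

Definition covers (lam : R) (S : set (ellipse R)) x y :=
  exists2 e, S e & gauge2 e x y <= lam ^+ 2.

Lemma opp_sideK s : opp_side (opp_side s) = s.
Proof. by rewrite /opp_side /= opprK; case: s. Qed.

Lemma bdry_le_opp s y : sb s <= 0 -> bdry s y <= bdry (opp_side s) y.
Proof. by move=> b0; rewrite /bdry /= lerD2l ler_wpM2r ?sqrtr_ge0 //; lra. Qed.

(** At the contact level the gap shrinks to one point, which lies on the boundary of whichever of
    [L] and [M] is not a wall. *)
Lemma side_covers_contact (lam : R) (L M : side R) x y : 1 < lam ->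
  0 <= sb L -> sb M <= 0 -> sb L != 0 \/ sb M != 0 ->
  0 <= y <= sH L -> 0 <= y <= sH M -> 0 < sH L -> 0 < sH M ->
  bdry L y = bdry M y -> bdry L y <= x <= bdry M y ->
  side_covers lam L x y \/ side_covers lam M x y.
Proof.
move=> lam1 bL bM bLM hy hy' LH MH e hx.
have ex : x = bdry L y by apply/le_anti; rewrite e in hx *; rewrite andbC.
case: bLM => b0; [left|right].
  split=> //; apply: (@le_trans _ _ 1); last by nra.
  have bL' : 0 < sb L by rewrite lt_def b0.
  apply: ellipse_of_le1 => //.
  rewrite ex lexx andbT -[X in _ <= bdry X _]opp_sideK bdry_le_opp //=; lra.
apply/side_covers_opp; split; first by rewrite /= oppr_eq0.
have bM' : 0 < - sb M by rewrite oppr_gt0 lt_def bM andbT eq_sym.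
apply: (@le_trans _ _ 1); last by nra.
by apply: ellipse_of_le1 => //=; rewrite opp_sideK ex e lexx bdry_le_opp.
Qed.

Lemma side_covers_across_tangent (lam t : R) (L M : side R) x y :
  0 <= sb L -> sb M <= 0 -> sb L != 0 \/ sb M != 0 ->
  bdry L t = bdry M t -> slope L t = slope M t ->
  0 < t < sH L -> 0 < t < sH M -> 0 <= y <= sH L -> 0 <= y <= sH M ->
  (y - t) ^+ 2 <= (lam ^+ 2 - 1) * (t * (sH L - t)) ->
  (y - t) ^+ 2 <= (lam ^+ 2 - 1) * (t * (sH M - t)) ->
  bdry L y <= x <= bdry M y -> side_covers lam L x y \/ side_covers lam M x y.
Proof.
move=> bL bM bLM eB eS tL tM yL yM hL hM /andP[hx1 hx2].
have tE z : tangent_at L t z = tangent_at M t z by rewrite /tangent_at eB eS.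
have flat (s : side R) z : sb s = 0 -> tangent_at s t z = bdry s z.
  by move=> b0; rewrite /tangent_at /bdry /slope b0 !mul0r; ring.
have right_case : tangent_at M t y <= x -> sb M != 0 -> side_covers lam M x y.
  move=> h b0; apply/side_covers_mirror; apply: (@side_covers_to_tangent _ _ _ t) => //=.
    by rewrite oppr_gt0 lt_def bM andbT eq_sym.
  by rewrite bdry_mirror tangent_mirror !lerN2 hx2.
have [xt|xt] := leP x (tangent_at L t y); last first.
  right; rewrite tE in xt; apply: right_case; first exact: ltW.
  by apply/eqP => /flat fl; rewrite fl in xt; lra.
(* If [L] is a wall, it is its own tangent, so the point is also on or to the right of the tangent
   of [M], and [M] is not a wall. *)
have [b0|b0] := eqVneq (sb L) 0; last first.
  left; apply: (@side_covers_to_tangent _ _ _ t) => //; last by rewrite hx1.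
  by rewrite lt_def bL b0.
right; apply: right_case; last by case: bLM => //; rewrite b0 eqxx.
by rewrite -tE flat.
Qed.

(** On each level the order is [L], left arc of [N], right arc of [N], [M], which separates the
    three families. As [L] and [M] are compared with [N] only up to [sH N], the two smaller gaps are
    cut off at a height h <= [sH N]. *)
Lemma packs_insert (L M N : side R) (h h' : R) (S1 S2 : set (ellipse R)) :
  0 < sb N -> 0 < sH N -> h <= sH N -> sH N <= h' ->
  (forall y, 0 <= y <= sH N -> bdry L y <= bdry (opp_side N) y) ->
  (forall y, 0 <= y <= sH N -> bdry N y <= bdry M y) ->
  packs S1 (fun x y => 0 < y < h /\ bdry L y < x < bdry (opp_side N) y) ->
  packs S2 (fun x y => 0 < y < h /\ bdry N y < x < bdry M y) ->
  packs ([set ellipse_of N] `|` S1 `|` S2) (fun x y => 0 < y < h' /\ bdry L y < x < bdry M y).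
Proof.
move=> bN HN hN Nh' leL leM [P1 D1 I1] [P2 D2 I2].
have leN y : bdry (opp_side N) y <= bdry N y.
  by rewrite -{2}[N]opp_sideK bdry_le_opp //= oppr_le0 ltW.
have DN x y := @ellipse_of_lt1 _ N x y bN HN.
have range y : 0 < y < h -> 0 <= y <= sH N /\ 0 < y < h'.
  move=> /andP[y0 yh]; have yN := le_trans (ltW yh) hN.
  by rewrite y0 (ltW y0) yN (lt_le_trans yh (le_trans hN Nh')).
split.
- move=> e [[->|/P1 //]|/P2 //] /=.
  by rewrite !mulf_neq0 ?invr_neq0 ?pnatr_eq0 ?gt_eqF.
- move=> e x y [[->|eS]|eS].
  + move=> /DN[/andP[y0 yH] /andP[x1 x2]].
    have hy : 0 <= y <= sH N by rewrite !ltW.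
    by rewrite y0 (lt_le_trans yH Nh') (le_lt_trans (leL _ hy) x1) (lt_le_trans x2 (leM _ hy)).
  + move=> /(D1 _ _ _ eS)[/range[hy ->] /andP[-> x2]]; split=> //=.
    exact: lt_le_trans x2 (le_trans (leN _) (leM _ hy)).
  + move=> /(D2 _ _ _ eS)[/range[hy ->] /andP[x1 ->]]; rewrite andbT; split=> //.
    exact: le_lt_trans (le_trans (leL _ hy) (leN _)) x1.
- have absurd (a b : R) (P : Prop) : a < b -> b <= a -> P.
    by move=> ab; rewrite leNgt ab.
  move=> e e' x y [[->|H]|H] [[->|H']|H'] //.
  + by move=> /DN[_ /andP[a _]] /(D1 _ _ _ H')[_ /andP[_ /ltW b]]; apply: absurd a b.
  + by move=> /DN[_ /andP[_ a]] /(D2 _ _ _ H')[_ /andP[/ltW b _]]; apply: absurd a b.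
  + by move=> /(D1 _ _ _ H)[_ /andP[_ /ltW b]] /DN[_ /andP[a _]]; apply: absurd a b.
  + exact: I1.
  + move=> /(D1 _ _ _ H)[_ /andP[_ b]] /(D2 _ _ _ H')[_ /andP[a _]].
    exact: absurd (lt_trans a b) (leN y).
  + by move=> /(D2 _ _ _ H)[_ /andP[/ltW b _]] /DN[_ /andP[_ a]]; apply: absurd a b.
  + move=> /(D2 _ _ _ H)[_ /andP[b _]] /(D1 _ _ _ H')[_ /andP[_ a]].
    exact: absurd (lt_trans b a) (leN y).
  + exact: I2.
Qed.

(** What [N] covers passes to the new family, whereas [L] and [M] bound the gap from outside and
    remain separate alternatives. *)
Lemma covers_insert (lam : R) (L M N : side R) (S1 S2 : set (ellipse R)) x y :
  1 < lam -> 0 < sb N -> 0 <= y <= sH N ->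
  0 < sH N ->
  (bdry L y <= x <= bdry (opp_side N) y ->
    [\/ side_covers lam L x y, side_covers lam (opp_side N) x y | covers lam S1 x y]) ->
  (bdry N y <= x <= bdry M y ->
    [\/ side_covers lam N x y, side_covers lam M x y | covers lam S2 x y]) ->
  bdry L y <= x <= bdry M y ->
  [\/ side_covers lam L x y, side_covers lam M x y |
      covers lam ([set ellipse_of N] `|` S1 `|` S2) x y].
Proof.
move=> lam1 bN hy HN C1 C2 /andP[hx1 hx2].
have covN : side_covers lam N x y -> covers lam ([set ellipse_of N] `|` S1 `|` S2) x y.
  by move=> [_ h]; exists (ellipse_of N) => //; left; left.
have [xN1|xN1] := leP x (bdry (opp_side N) y).
  have [|h|h|[e eS1 h]] := C1; first by rewrite hx1.
  - exact: Or31.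
  - by apply: Or33; apply/covN/side_covers_opp.
  - by apply: Or33; exists e => //; left; right.
have [xN2|xN2] := leP (bdry N y) x.
  have [|h|h|[e eS1 h]] := C2; first by rewrite xN2.
  - by apply: Or33; apply: covN.
  - exact: Or32.
  - by apply: Or33; exists e => //; right.
apply/Or33/covN; split; first by rewrite gt_eqF.
apply: (@le_trans _ _ 1); last by nra.
by apply: ellipse_of_le1 => //; rewrite !ltW.
Qed.

(** The common tangent at height t + 1 splits the width of the gap at height t. Adding the estimates
    of [tangent_ratio_bound] for [L] and for the mirrored [M] gives the hypotheses of
    [conic_in_wedge]; the width is positive because one of the two is not a wall. *)
Lemma inscribed_conic (t : R) (L M : side R) : 1 <= t ->
  0 <= sb L -> sb M <= 0 -> sb L != 0 \/ sb M != 0 ->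
  t + 1 < sH L -> t + 1 < sH M ->
  bdry L (t + 1) = bdry M (t + 1) -> slope L (t + 1) = slope M (t + 1) ->
  exists N : side R, [/\ 0 < sb N, t + 1 / 9 <= sH N < t + 1,
    bdry L t = bdry (opp_side N) t /\ slope L t = slope (opp_side N) t,
    bdry N t = bdry M t /\ slope N t = slope M t &
    forall y, 0 <= y <= sH N -> bdry L y <= bdry (opp_side N) y /\ bdry N y <= bdry M y].
Proof.
move=> t1 bL bM bLM HL HM eB eS.
have g_facts : [/\ 0 < bdry M t - bdry L t,
    slope L t - slope M t <= 3 * (bdry M t - bdry L t) &
    bdry M t - bdry L t <= slope L t - slope M t].
  have tE : tangent_at L (t + 1) t = tangent_at M (t + 1) t by rewrite /tangent_at eB eS.
  have bM' : 0 <= sb (mirror_side M) by rewrite /= oppr_ge0.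
  have [DL0 DL1 DL3 DLS] := tangent_ratio_bound bL t1 HL.
  have [DM0 DM1 DM3 DMS] := @tangent_ratio_bound _ (mirror_side M) t bM' t1 HM.
  move: DM0 DM1 DM3 DMS; rewrite /= !bdry_mirror !slope_mirror !tangent_mirror.
  rewrite tE eS in DL0 DL1 DL3 DLS => DM0 DM1 DM3 DMS.
  have g0 : 0 < bdry M t - bdry L t.
    case: bLM => b0.
      have /DL1 : 0 < sb L by rewrite lt_def b0.
      by clear -DM0 => h; lra.
    have /DM1 : 0 < - sb M by rewrite oppr_gt0 lt_def bM andbT eq_sym.
    by clear -DL0 => h; lra.
  by clear -g0 DL3 DLS DM3 DMS; split=> //; lra.
have [g0 g3 g1] := g_facts.
have [N [bN HN [eBl eSl] [eBr eSr]]] := conic_in_wedge t1 g0 g3 g1.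
(* The common tangents at height t separate [N] from [L] and from [M]. *)
exists N; split=> // y /andP[y0 yN].
have /andP[HN1 HN2] := HN.
have tN : 0 < t < sH N by clear -t1 HN1; apply/andP; split; lra.
have tL : 0 < t < sH L by clear -t1 HL; apply/andP; split; lra.
have tM : 0 < t < sH M by clear -t1 HM; apply/andP; split; lra.
have yL : 0 <= y <= sH L by rewrite y0; clear -yN HN2 HL; lra.
have yM : 0 <= y <= sH M by rewrite y0; clear -yN HN2 HM; lra.
have yN' : 0 <= y <= sH N by rewrite y0.
split.
  apply: (le_trans (bdry_le_tangent bL tL yL)).
  rewrite /tangent_at -eBl -eSl; apply: (@tangent_le_bdry _ (opp_side N)) => //=.
  by rewrite oppr_le0 ltW.
apply: (le_trans _ (tangent_le_bdry bM tM yM)).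
by rewrite /tangent_at -eBr -eSr; apply: bdry_le_tangent => //; rewrite ltW.
Qed.

(** The left side is at most 1, while t + 1 >= K and H - (t + 1) >= 1/9, so K (lam^2 - 1) >= 9
    suffices. *)
Lemma level_step (lam t H y : R) (K : nat) : (0 < K)%N -> 1 < lam ->
  9 <= K%:R * (lam ^+ 2 - 1) -> K%:R <= t -> t <= y <= t + 1 -> t + 1 + 1 / 9 <= H ->
  [/\ 0 < t + 1 < H, 0 <= y <= H &
      (y - (t + 1)) ^+ 2 <= (lam ^+ 2 - 1) * ((t + 1) * (H - (t + 1)))].
Proof.
move=> K0 lam1 hK Kt /andP[ty yt] tH.
have K1 : 1 <= K%:R :> R by rewrite -[1]/(1%:R) ler_nat.
split; [by apply/andP; split; lra | by apply/andP; split; lra | ].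
have yt1 : (y - (t + 1)) ^+ 2 <= 1 by nra.
apply: (le_trans yt1).
have lam2 : 0 <= lam ^+ 2 - 1 by nra.
have : K%:R * (lam ^+ 2 - 1) * (1 / 9) <= (t + 1) * (lam ^+ 2 - 1) * (H - (t + 1)).
  by apply: ler_pM; rewrite ?mulr_ge0 ?ler_wpM2r //; lra.
by clear -hK; lra.
Qed.

Lemma fill_gap (lam : R) (K : nat) : 1 < lam -> (0 < K)%N ->
  9 <= K%:R * (lam ^+ 2 - 1) ->
  forall (i : nat) (L M : side R), (K <= i)%N ->
  0 <= sb L -> sb M <= 0 -> sb L != 0 \/ sb M != 0 ->
  i%:R + 1 / 9 <= sH L -> i%:R + 1 / 9 <= sH M ->
  bdry L i%:R = bdry M i%:R -> slope L i%:R = slope M i%:R ->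
  exists S : set (ellipse R),
    packs S (fun x y => 0 < y < i%:R /\ bdry L y < x < bdry M y) /\
    forall x y, K%:R <= y <= i%:R -> bdry L y <= x <= bdry M y ->
      [\/ side_covers lam L x y, side_covers lam M x y | covers lam S x y].
Proof.
move=> lam1 K0 hK; elim=> [|i IH] L M Ki bL bM bLM HL HM eB eS.
  by move: Ki K0; rewrite leqn0 => /eqP ->.
have K1 : 1 <= K%:R :> R by rewrite -[1]/(1%:R) ler_nat.
have i0 : 0 <= i%:R :> R by rewrite ler0n.
rewrite -natr1 in HL HM eB eS *.
have LH : 0 < sH L by lra.
have MH : 0 < sH M by lra.
(* If the contact height is K itself, only the contact level has to be covered and no ellipse is
   inserted. *)
move: Ki; rewrite leq_eqVlt => /orP[/eqP Ki|].
  exists set0; split; first by split.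
  move=> x y; rewrite Ki -natr1 => /le_anti <- hx.
  have iL : 0 <= (i%:R + 1 : R) <= sH L by clear -i0 HL; apply/andP; split; lra.
  have iM : 0 <= (i%:R + 1 : R) <= sH M by clear -i0 HM; apply/andP; split; lra.
  have [h|h] := side_covers_contact lam1 bL bM bLM iL iM LH MH eB hx.
  - exact: Or31.
  - exact: Or32.
rewrite ltnS => Ki.
have Ki1 : K%:R <= i%:R :> R by rewrite ler_nat.
have i1 : 1 <= i%:R :> R by apply: le_trans Ki1.
have LH1 : i%:R + 1 < sH L by clear -HL; lra.
have MH1 : i%:R + 1 < sH M by clear -HM; lra.
have [N [bN /andP[HN1 HN2] [eBl eSl] [eBr eSr] leN]] :=
  inscribed_conic i1 bL bM bLM LH1 MH1 eB eS.
have bN' : sb (opp_side N) <= 0 by rewrite /= oppr_le0 ltW.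
have nN : sb N != 0 by rewrite gt_eqF.
have nN' : sb (opp_side N) != 0 by rewrite /= oppr_eq0.
have HL' : i%:R + 1 / 9 <= sH L by clear -HL; lra.
have HM' : i%:R + 1 / 9 <= sH M by clear -HM; lra.
have [S1 [PS1 C1]] := IH L (opp_side N) Ki bL bN' (or_intror nN') HL' HN1 eBl eSl.
have [S2 [PS2 C2]] := IH N M Ki (ltW bN) bM (or_introl nN) HN1 HM' eBr eSr.
have iN : i%:R <= sH N by clear -HN1; lra.
have HN0 : 0 < sH N by clear -i1 iN; lra.
exists ([set ellipse_of N] `|` S1 `|` S2); split.
  apply: (packs_insert bN HN0 iN (ltW HN2) _ _ PS1 PS2) => y /leN[] //.
move=> x y /andP[yK yi] hx.
(* From height i upwards [L] and [M] do the covering, on the two sides of their common tangent;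
   below it the two smaller gaps and [N] take over. *)
have [iy|iy] := leP i%:R y.
  have iyi : i%:R <= y <= i%:R + 1 by rewrite iy.
  have [tL yL sL] := level_step K0 lam1 hK Ki1 iyi HL.
  have [tM yM sM] := level_step K0 lam1 hK Ki1 iyi HM.
  have [h|h] := side_covers_across_tangent bL bM bLM eB eS tL tM yL yM sL sM hx.
  - exact: Or31.
  - exact: Or32.
have hy : K%:R <= y <= i%:R by rewrite yK ltW.
apply: (covers_insert lam1 bN _ HN0 _ _ hx).
- by rewrite (le_trans (ltW iy) iN) andbT (le_trans _ yK).
- exact: C1.
- exact: C2.
Qed.
End Gap.

(** * Affine images of packings, and packing a rectangle *)

Section Rectangle.
Variable R : realType.
Implicit Types (s L N : side R) (x y t lam : R) (e : ellipse R) (S : set (ellipse R)).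

Lemma packsW S (D D' : R -> R -> Prop) :
  (forall x y, D x y -> D' x y) -> packs S D -> packs S D'.
Proof. by move=> DD' [P Q I]; split=> // e x y eS /(Q _ _ _ eS)/DD'. Qed.

Lemma packs_bigcup (I : Type) (S : I -> set (ellipse R)) (D : I -> R -> R -> Prop) :
  (forall i, packs (S i) (D i)) ->
  (forall i j x y, D i x y -> D j x y -> i = j) ->
  packs (\bigcup_i S i) (fun x y => exists i, D i x y).
Proof.
move=> PS DD; split.
- by move=> e [i _ eS]; have [P _ _] := PS i; apply: P.
- by move=> e x y [i _ eS] h; exists i; have [_ Q _] := PS i; apply: Q eS h.
- move=> e e' x y [i _ eS] [j _ eS'] h h'.
  have [_ Q In] := PS i; have [_ Q' _] := PS j.
  have ij := DD _ _ _ _ (Q _ _ _ eS h) (Q' _ _ _ eS' h').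
  by rewrite -ij in eS'; apply: In h h'.
Qed.

Lemma packs_setU S1 S2 (D1 D2 : R -> R -> Prop) :
  packs S1 D1 -> packs S2 D2 -> (forall x y, D1 x y -> D2 x y -> False) ->
  packs (S1 `|` S2) (fun x y => D1 x y \/ D2 x y).
Proof.
move=> [P1 Q1 I1] [P2 Q2 I2] DD; split.
- by move=> e [/P1|/P2].
- by move=> e x y [eS /(Q1 _ _ _ eS)|eS /(Q2 _ _ _ eS)]; [left|right].
- move=> e e' x y [eS|eS] [eS'|eS'] h h'.
  + exact: I1 h h'.
  + by have := DD _ _ (Q1 _ _ _ eS h) (Q2 _ _ _ eS' h').
  + by have := DD _ _ (Q1 _ _ _ eS' h') (Q2 _ _ _ eS h).
  + exact: I2 h h'.
Qed.

Lemma packs_set1 e : hw e != 0 -> hh e != 0 ->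
  packs [set e] (fun x y => gauge2 e x y < 1).
Proof. by move=> w h; split=> [e' ->|e' x y ->|e' e'' x y -> ->]. Qed.

Definition affine_ellipse (a b p r : R) e :=
  Ellipse (a * cx e + p) (b * cy e + r) (a * sh e / b) (a * hw e) (b * hh e).

Lemma gauge2_affine (a b p r : R) e x y : a != 0 -> b != 0 ->
  gauge2 (affine_ellipse a b p r e) (a * x + p) (b * y + r) = gauge2 e x y.
Proof.
move=> a0 b0; rewrite /gauge2 /=; congr (_ ^+ 2 + _ ^+ 2).
  have -> : a * x + p - (a * cx e + p) - a * sh e / b * (b * y + r - (b * cy e + r)) =
    a * (x - cx e - sh e * (y - cy e)) by field.
  by rewrite invfM mulrACA divff // mul1r.
have -> : b * y + r - (b * cy e + r) = b * (y - cy e) by ring.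
by rewrite invfM mulrACA divff // mul1r.
Qed.

Lemma affineK (a p x : R) : a != 0 -> a * ((x - p) / a) + p = x.
Proof. by move=> a0; rewrite mulrC divfK // subrK. Qed.

Lemma packs_affine (a b p r : R) S D : a != 0 -> b != 0 -> packs S D ->
  packs (affine_ellipse a b p r @` S) (fun x y => D ((x - p) / a) ((y - r) / b)).
Proof.
move=> a0 b0 [P Q I].
have E e x y : gauge2 (affine_ellipse a b p r e) x y = gauge2 e ((x - p) / a) ((y - r) / b).
  by rewrite -(gauge2_affine p r e _ _ a0 b0) !affineK.
split.
- by move=> _ [e /P[w h] <-]; rewrite /= !mulf_neq0.
- by move=> _ x y [e eS <-]; rewrite E; apply: Q.
- by move=> _ _ x y [e eS <-] [e' eS' <-]; rewrite !E => h h'; congr affine_ellipse; apply: I h h'.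
Qed.

Lemma covers_affine lam (a b p r : R) S x y : a != 0 -> b != 0 ->
  covers lam S ((x - p) / a) ((y - r) / b) -> covers lam (affine_ellipse a b p r @` S) x y.
Proof.
move=> a0 b0 [e eS h]; exists (affine_ellipse a b p r e); first by exists e.
by move: h; rewrite -(gauge2_affine p r e _ _ a0 b0) !affineK.
Qed.

Lemma covers_sub lam S S' x y : S `<=` S' -> covers lam S x y -> covers lam S' x y.
Proof. by move=> SS [e eS h]; exists e => //; apply: SS. Qed.

(** The inscribed ellipse touches both walls at height m with vertical tangents, so [fill_gap]
    applies with contact height m to the two lower gaps; a point reflection fills the upper ones. *)
Lemma fill_tall_rect lam (K m : nat) : 1 < lam -> (0 < K)%N ->
  9 <= K%:R * (lam ^+ 2 - 1) -> (K <= m)%N ->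
  exists S, packs S (fun x y => 0 < x < 1 /\ 0 < y < 2 * m%:R) /\
    forall x y, 0 <= x <= 1 -> K%:R <= y <= 2 * m%:R - K%:R -> covers lam S x y.
Proof.
move=> lam1 K0 hK Km.
have m1 : 1 <= m%:R :> R by rewrite -[1]/(1%:R) ler_nat (leq_trans K0 Km).
set h : R := 2 * m%:R.
have h2 : h - m%:R = m%:R by rewrite /h; ring.
have h0 : 0 < h by rewrite /h; lra.
pose W0 := @Side R 0 0 0 h; pose W1 := @Side R 1 0 0 h.
(* At height m = h / 2 the square root is m, so the value 1 / h of [sb] gives the half-width 1/2. *)
pose T := @Side R (1 / 2) 0 h^-1 h.
have T0 : 0 < sb T by rewrite /= invr_gt0.
have bd0 y : bdry W0 y = 0 by rewrite /bdry /=; ring.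
have bd1 y : bdry W1 y = 1 by rewrite /bdry /=; ring.
have sqrtm : Num.sqrt (m%:R * (h - m%:R)) = m%:R by rewrite h2 -expr2 sqrtr_sqr ger0_norm; lra.
have bT : bdry T m%:R = 1.
  by rewrite /bdry /= sqrtm /h; field; rewrite gt_eqF; lra.
have boT : bdry (opp_side T) m%:R = 0.
  by rewrite /bdry /= sqrtm /h; field; rewrite gt_eqF; lra.
have mh : m%:R + 1 / 9 <= h by rewrite /h; lra.
have To0 : sb (opp_side T) <= 0 by rewrite /= oppr_le0 ltW.
have nT : sb T != 0 by rewrite gt_eqF.
have nT' : sb (opp_side T) != 0 by rewrite /= oppr_eq0.
have slo (s : side R) : sk s = 0 -> sH s = h -> slope s m%:R = 0.
  by move=> k0 sh; rewrite /slope k0 sh /h subrr mulr0 mul0r addr0.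
have [S1 [PS1 C1]] := @fill_gap R lam K lam1 K0 hK m W0 (opp_side T) Km (lexx 0) To0
  (or_intror nT') mh mh (etrans (bd0 _) (esym boT)) (etrans (slo W0 erefl erefl) (esym (slo (opp_side T) erefl erefl))).
have [S2 [PS2 C2]] := @fill_gap R lam K lam1 K0 hK m T W1 Km (ltW T0) (lexx 0)
  (or_introl nT) mh mh (etrans bT (esym (bd1 _))) (etrans (slo T erefl erefl) (esym (slo W1 erefl erefl))).
have mT : 0 < (m%:R : R) < h by rewrite /h; clear -m1; apply/andP; split; lra.
have tg y : tangent_at T m%:R y = 1 by rewrite /tangent_at bT (slo T) // mul0r addr0.
have tgo y : tangent_at (opp_side T) m%:R y = 0 by rewrite /tangent_at boT (slo (opp_side T)) // mul0r addr0.
have DT x y := @ellipse_of_lt1 _ T x y T0 h0.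
have leT y : bdry (opp_side T) y <= bdry T y.
  by rewrite -{2}[T]opp_sideK bdry_le_opp.
have q0 y : 0 <= Num.sqrt (y * (h - y)) by apply: sqrtr_ge0.
have ih : 0 < h^-1 by rewrite invr_gt0.
have half1 y : bdry (opp_side T) y <= 1 / 2.
  rewrite /bdry /= mul0r addr0 mulNr gerDl oppr_le0 mulr_ge0 // ltW //.
have half2 y : 1 / 2 <= bdry T y.
  by rewrite /bdry /= mul0r addr0 lerDl mulr_ge0 // ltW.
(* The interior of [T] is excluded so that [T] itself can be added at the end. *)
pose DA (x y : R) := (0 < y < m%:R /\ 0 < x < 1) /\ ~ gauge2 (ellipse_of T) x y < 1.
have PA : packs (S1 `|` S2) DA.
  apply: packsW (packs_setU PS1 PS2 _).
    move=> x y [[hy hx]|[hy hx]]; (split; first split=> //).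
    - by move: hx; rewrite bd0 => /andP[-> /= hx]; have := half1 y; lra.
    - by move=> /DT[_ /andP[a _]]; case/andP: hx => _ b; have := lt_trans a b; rewrite ltxx.
    - by move: hx; rewrite bd1 => /andP[hx ->]; have := half2 y; lra.
    - by move=> /DT[_ /andP[_ a]]; case/andP: hx => b _; have := lt_trans a b; rewrite ltxx.
  move=> x y [_ /andP[_ a]] [_ /andP[b _]].
  by have := le_lt_trans (leT y) (lt_trans b a); rewrite ltxx.
have n1 : -1 != 0 :> R by rewrite oppr_eq0 oner_eq0.
(* The reflection (x, y) -> (1 - x, h - y) in the centre of the rectangle; it maps [T] to itself. *)
pose A' := affine_ellipse (-1) (-1) 1 h @` (S1 `|` S2).
have PA' := packs_affine 1 h n1 n1 PA.
have rf (c z : R) : (z - c) / -1 = c - z by rewrite invrN invr1 mulrN1 opprB.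
have gT x y : gauge2 (ellipse_of T) (1 - x) (h - y) = gauge2 (ellipse_of T) x y.
  by rewrite /gauge2 /=; congr (_ + _); rewrite -sqrrN -mulNr; congr ((_ / _) ^+ 2); field.
exists (S1 `|` S2 `|` A' `|` [set ellipse_of T]); split.
  have PT : packs [set ellipse_of T] (fun x y => gauge2 (ellipse_of T) x y < 1).
    by apply: packs_set1; apply: lt0r_neq0; rewrite /= ?mulVf ?divr_gt0 ?lt0r_neq0.
  apply: packsW (packs_setU (packs_setU PA PA' _) PT _).
  - move=> x y [[[[hy hx] _]|]|/DT[hy /andP[x1 x2]]].
    + by split=> //; clear -hy h2; lra.
    + by rewrite /DA !rf => -[[hy hx] _]; split; clear -hy hx h2; lra.
    + have hy' : 0 <= y <= h by case/andP: hy => *; rewrite !ltW.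
      split=> //; apply/andP; split.
        by apply: le_lt_trans x1; apply: le_trans (tangent_le_bdry To0 mT hy'); rewrite tgo.
      by apply: lt_le_trans x2 _; apply: le_trans (bdry_le_tangent (ltW T0) mT hy') _; rewrite tg.
  - move=> x y [[hy _] _]; rewrite /DA !rf => -[[hy' _] _].
    by clear -hy hy' h2; lra.
  - by move=> x y [[_ g]|] //; rewrite /DA !rf => -[_]; rewrite gT.
have low x y : 0 <= x <= 1 -> K%:R <= y <= m%:R ->
    covers lam ([set ellipse_of T] `|` S1 `|` S2) x y.
  move=> hx hy.
  have [||||] := @covers_insert _ lam W0 W1 T S1 S2 x y lam1 T0 _ h0 (C1 x y hy) (C2 x y hy).
  - by have := ler0n R K; clear -hy h2 h0 => ?; apply/andP; split=> /=; lra.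
  - by rewrite bd0 bd1.
  - by case; rewrite /= eqxx.
  - by case; rewrite /= eqxx.
  - by [].
move=> x y hx hy; have [ym|ym] := leP y m%:R.
  apply: covers_sub (low x y hx _); last by rewrite ym andbT; case/andP: hy.
  by move=> e [[->|]|]; [right|left; left; left|left; left; right].
have [||e Te g] := low (1 - x) (h - y).
- by clear -hx; lra.
- by clear -hy ym h2; lra.
case: Te => [[Te|Te]|Te].
- by exists e; [right|move: g; rewrite Te gT].
- apply: (@covers_sub _ A'); first by move=> ? ?; left; right.
  by apply: covers_affine => //; rewrite !rf; exists e => //; left.
- apply: (@covers_sub _ A'); first by move=> ? ?; left; right.
  by apply: covers_affine => //; rewrite !rf; exists e => //; right.
Qed.

(** K depends on [lam] only, while m is free: after rescaling the height 2 m to v - u, the uncovered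
    strips have height K (v - u) / (2 m), at most [tau] for large m. *)
Lemma fill_rect lam (p q u v tau : R) : 1 < lam -> p < q -> u < v -> 0 < tau ->
  exists S, packs S (fun x y => p < x < q /\ u < y < v) /\
    forall x y, p <= x <= q -> u + tau <= y <= v - tau -> covers lam S x y.
Proof.
move=> lam1 pq uv tau0.
have lam2 : 0 < lam ^+ 2 - 1 by nra.
pose K := (Num.bound (9 / (lam ^+ 2 - 1))).+1.
have hK : 9 <= K%:R * (lam ^+ 2 - 1).
  rewrite -ler_pdivrMr //; apply: ltW.
  apply: (@lt_trans _ _ (Num.bound (9 / (lam ^+ 2 - 1)))%:R); last by rewrite ltr_nat.
  by rewrite archi_boundP // divr_ge0 // ltW.
pose m := maxn K (Num.bound (K%:R * (v - u) / tau)).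
have vu : 0 < v - u by rewrite subr_gt0.
have hm : K%:R * (v - u) / tau <= m%:R.
  apply: (@le_trans _ _ (Num.bound (K%:R * (v - u) / tau))%:R); last by rewrite ler_nat leq_maxr.
  by rewrite ltW // archi_boundP // divr_ge0 ?mulr_ge0 ?ltW.
have [S [PS CS]] := @fill_tall_rect lam K m lam1 isT hK (leq_maxl _ _).
have m0 : 0 < m%:R :> R by rewrite ltr0n leq_max.
have a0 : q - p != 0 by rewrite subr_eq0 gt_eqF.
pose b := (v - u) / (2 * m%:R).
have b0 : 0 < b by rewrite /b divr_gt0 // mulr_gt0.
have b1 : b != 0 by rewrite gt_eqF.
have bm : b * (2 * m%:R) = v - u by rewrite /b divfK // gt_eqF // mulr_gt0.
have bK : b * K%:R <= tau.
  move: hm; rewrite ler_pdivrMr // => hm.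
  by rewrite /b mulrAC ler_pdivrMr ?mulr_gt0 //; nra.
exists (affine_ellipse (q - p) b p u @` S); split.
  apply: packsW (packs_affine p u a0 b1 PS) => x y [].
  have qp : 0 < q - p by rewrite subr_gt0.
  move=> /andP[x0 x1] /andP[y0 y1].
  move: x0 x1 y0 y1; rewrite !pmulr_lgt0 ?invr_gt0 // [_ < 1]ltr_pdivrMr //.
  rewrite [_ < 2 * _]ltr_pdivrMr //; clear -bm => *.
  by split; apply/andP; split; lra.
move=> x y hx hy; apply: covers_affine => //; apply: CS.
  rewrite divr_ge0 ?subr_ge0 ?(ltW pq) ?ler_pdivrMr ?subr_gt0 ?mul1r //; last by case/andP: hx.
  by clear -hx; lra.
rewrite ler_pdivlMr // ler_pdivrMr //; clear -hy bK bm.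
by apply/andP; split; lra.
Qed.
End Rectangle.

(** * From ellipse parameters to point sets: bodies, centres, enlargements *)

Section Plane.
Variable R : realType.
Local Notation plane := 'rV[R]_2.
Implicit Types (e : ellipse R) (v w : plane) (lam : R).

Definition vec (x y : R) : plane := \row_(j < 2) (if j == 0 then x else y).

Lemma vec0 x y : vec x y 0 0 = x. Proof. by rewrite mxE. Qed.
Lemma vec1 x y : vec x y 0 1 = y. Proof. by rewrite mxE. Qed.

Lemma vecP v w : v 0 0 = w 0 0 -> v 0 1 = w 0 1 -> v = w.
Proof.
move=> h0 h1; apply/matrixP => i j; rewrite (ord1 i).
case: j => -[|[|//]] lt.
- by rewrite (_ : Ordinal lt = 0) //; apply: val_inj.
- by rewrite (_ : Ordinal lt = 1) //; apply: val_inj.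
Qed.

Definition region e : set plane := [set v | gauge2 e (v 0 0) (v 0 1) <= 1].

Definition center e : plane := vec (cx e) (cy e).

Definition nondegenerate e := hw e != 0 /\ hh e != 0.

Lemma region_is_ellipse e : nondegenerate e -> is_ellipse (region e).
Proof.
move=> [w0 h0].
(* Matrices act on row vectors from the right, so the rows are the half-diameters (hw, 0) and (sh
   hh, hh). *)
pose A : 'M[R]_2 := \matrix_(i, j)
  (if i == 0 then (if j == 0 then hw e else 0)
   else (if j == 0 then sh e * hh e else hh e)).
have AE v : v *m A = vec (v 0 0 * hw e + v 0 1 * (sh e * hh e)) (v 0 1 * hh e).
  apply: vecP; rewrite ?vec0 ?vec1 mxE big_ord_recl big_ord1 !mxE /=.
    by congr (v _ _ * _ + v _ _ * _); apply: val_inj.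
  by rewrite mulr0 add0r; congr (v _ _ * _); apply: val_inj.
exists A, (center e); split.
  rewrite unitmxE det_trig; last by apply/is_trig_mxP => -[[|[|//]] ?] [[|[|//]] ?] //; rewrite mxE.
  by rewrite big_ord_recl big_ord1 !mxE unitfE mulf_neq0.
apply/seteqP; split=> [v hv|_ [v hv <-]]; last first.
  rewrite /region /= AE !mxE /= /gauge2.
  move: hv; rewrite /unit_disc /=; apply: le_trans; rewrite le_eqVlt; apply/orP; left; apply/eqP.
  by field; rewrite ?w0 ?h0.
exists (vec ((v 0 0 - cx e - sh e * (v 0 1 - cy e)) / hw e) ((v 0 1 - cy e) / hh e)).
  by rewrite /unit_disc /= vec0 vec1.
apply: vecP; rewrite AE !mxE /=; first by field; rewrite ?w0 ?h0.
by field.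
Qed.

Lemma gauge2_continuous e : continuous (fun v : plane => gauge2 e (v 0 0) (v 0 1)).
Proof.
move=> v; rewrite /gauge2.
have c0 : {for v, continuous (fun v : plane => v 0 0)} by apply: coord_continuous.
have c1 : {for v, continuous (fun v : plane => v 0 1)} by apply: coord_continuous.
have cst (c : R) : {for v, continuous (fun _ : plane => c)} by apply: cst_continuous.
have cB1 := continuousB c1 (cst (cy e)).
have cB0 := continuousB (continuousB c0 (cst (cx e))) (continuousM (cst (sh e)) cB1).
have d0 := continuousM cB0 (cst (hw e)^-1).
have d1 := continuousM cB1 (cst (hh e)^-1).
exact: continuousD (continuousM d0 d0) (continuousM d1 d1).
Qed.

Lemma region_compact e : nondegenerate e -> compact (region e).
Proof.
move=> [w0 h0].
(* The shear adds at most |sh| |hh| to the horizontal extent. *)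
pose B0 := `|hw e| + `|sh e| * `|hh e|.
pose side i : set R := `[(center e) 0 i - (if i == 0 then B0 else `|hh e|),
   (center e) 0 i + (if i == 0 then B0 else `|hh e|)]%classic.
pose box := [set v : plane | forall i, side i (v ord0 i)].
apply: (@subclosed_compact _ _ box).
- have /continuous_closedP cc := @gauge2_continuous e.
  exact: (cc [set x | x <= 1] (@closed_le _ 1)).
- by apply: (@rV_compact R 2 side) => i; apply: segment_compact.
move=> v hv i; rewrite /side set_itvE /= -ler_distl.
have sq_le1 (a b : R) : b != 0 -> (a / b) ^+ 2 <= 1 -> `|a| <= `|b|.
  move=> b0; rewrite -[X in _ <= X](expr1n _ 2) -real_normK ?num_real //.
  by rewrite ler_pXn2r // ?nnegrE // normrM normfV ler_pdivrMr ?normr_gt0 // mul1r.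
have y1 : `|v 0 1 - cy e| <= `|hh e|.
  by apply: sq_le1 => //; apply: le_trans hv; rewrite lerDr sqr_ge0.
have x1 : `|v 0 0 - cx e| <= B0.
  rewrite -[_ - cx e](subrK (sh e * (v 0 1 - cy e))) (le_trans (ler_normD _ _)) //.
  apply: lerD; last by rewrite normrM ler_wpM2l.
  by apply: sq_le1 => //; apply: le_trans hv; rewrite lerDl sqr_ge0.
case: i => -[|[|//]] lt; rewrite !mxE /= -?[Ordinal lt]/0.
- by rewrite (_ : Ordinal lt = 0) //; apply: val_inj.
- by rewrite (_ : Ordinal lt = 1) //; apply: val_inj.
Qed.

(** [gauge2] is a sum of two squares of affine functions. *)
Lemma region_convex e : convex_set (region e).
Proof.
move=> v w t; rewrite !inE /region /= => hv hw'.
rewrite /gauge2.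
pose X (u : plane) := (u 0 0 - cx e - sh e * (u 0 1 - cy e)) / hw e.
pose Y (u : plane) := (u 0 1 - cy e) / hh e.
have t0 : 0 <= t%:num by [].
have t1 : t%:num <= 1 by [].
have cE : conv t v w = t%:num *: (v : plane) + (1 - t%:num) *: (w : plane) by [].
have XE : X (conv t v w) = t%:num * X v + (1 - t%:num) * X w.
  by rewrite cE /X !mxE; ring.
have YE : Y (conv t v w) = t%:num * Y v + (1 - t%:num) * Y w.
  by rewrite cE /Y !mxE; ring.
rewrite -/(X _) -/(Y _) XE YE.
move: hv hw'; rewrite /gauge2 -/(X _) -/(Y _) -/(X _) -/(Y _).
move: (t%:num) t0 t1 (X v) (X w) (Y v) (Y w) => r r0 r1 a a' b b' h h'.
have -> : (r * a + (1 - r) * a') ^+ 2 + (r * b + (1 - r) * b') ^+ 2 =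
    r * (a ^+ 2 + b ^+ 2) + (1 - r) * (a' ^+ 2 + b' ^+ 2) -
    r * (1 - r) * ((a - a') ^+ 2 + (b - b') ^+ 2) by ring.
have r2 : 0 <= 1 - r by rewrite subr_ge0.
have h1 := ler_wpM2l r0 h; have h2 := ler_wpM2l r2 h'.
have h3 : 0 <= r * (1 - r) * ((a - a') ^+ 2 + (b - b') ^+ 2).
  by rewrite !mulr_ge0 // addr_ge0 // sqr_ge0.
by lra.
Qed.

Lemma gauge2_center e : gauge2 e (cx e) (cy e) = 0.
Proof. by rewrite /gauge2 !subrr mulr0 subr0 !mul0r expr0n addr0. Qed.

Lemma center_interior e : (region e)° (center e).
Proof.
have := @gauge2_continuous e (center e); rewrite /= => c.
have g0 : gauge2 e ((center e) 0 0) ((center e) 0 1) < 1 by rewrite vec0 vec1 gauge2_center.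
have H := cvgr_lt _ c _ g0.
rewrite /interior /=; near=> v; apply: ltW; near: v; exact: H.
Unshelve. all: by end_near.
Qed.

(** Stretching from the centre by 1 + t multiplies the gauge by (1 + t)^2. For small t > 0 an
    interior point stays in the region, so its own gauge is below 1. *)
Lemma interior_region e v : (region e)° v -> gauge2 e (v 0 0) (v 0 1) < 1.
Proof.
move=> hv.
have gE (t : R) : gauge2 e ((v + t *: (v - center e)) 0 0) ((v + t *: (v - center e)) 0 1) =
    (1 + t) ^+ 2 * gauge2 e (v 0 0) (v 0 1).
  by rewrite /gauge2 !mxE /=; ring.
have [t [t0 ht]] : exists t : R, 0 < t /\ region e (v + t *: (v - center e)).
  have ct : v + t *: (v - center e) @[t --> (0 : R)^'+] --> v.
    rewrite -[X in _ --> X]addr0 -(scale0r (v - center e)).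
    apply: cvgD; first exact: cvg_cst.
    by apply: cvgZr_tmp; apply: cvg_at_right_filter; apply: cvg_id.
  apply: (@filter_ex _ (0 : R)^'+).
  by near=> t; split; near: t; [exact: nbhs_right_gt | exact: (ct (region e) hv)].
move: ht; rewrite /region /= gE => ht.
have [//|g1] := ltP (gauge2 e (v 0 0) (v 0 1)) 1.
have : 1 < (1 + t) ^+ 2 by rewrite expr2; nra.
by move=> t2; have := lt_le_trans t2 (le_trans (ler_peMr _ g1) ht); rewrite ltxx ?sqr_ge0 => ->.
Unshelve. all: by end_near.
Qed.

Lemma region_symmetric e : is_symmetry_center (region e) (center e).
Proof.
move=> v; rewrite /region /= mulr2n !mxE /=.
by apply: le_trans; rewrite le_eqVlt /gauge2; apply/orP; left; apply/eqP; ring.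
Qed.

(** Let (U, V) be c in the coordinates that turn the ellipse into the unit disc. Reflecting (0, 1)
    and (0, -1) in c gives (2U)^2 + (2V - 1)^2 <= 1 and (2U)^2 + (2V + 1)^2 <= 1; their sum forces U
    = V = 0. *)
Lemma region_center_unique e c : nondegenerate e ->
  is_symmetry_center (region e) c -> c = center e.
Proof.
move=> [w0 h0] hc.
have h (s : R) : s ^+ 2 = 1 ->
    gauge2 e (2 * c 0 0 - (cx e + s * (sh e * hh e))) (2 * c 0 1 - (cy e + s * hh e)) <= 1.
  move=> s2; have := hc (vec (cx e + s * (sh e * hh e)) (cy e + s * hh e)).
  rewrite /region /= mulr2n !mxE /= => hcs.
  have -> : 2 * c 0 0 = c 0 0 + c 0 0 by ring.
  have -> : 2 * c 0 1 = c 0 1 + c 0 1 by ring.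
  apply: hcs.
  rewrite le_eqVlt /gauge2 -s2; apply/orP; left; apply/eqP.
  by field; rewrite ?w0 ?h0.
pose U := (c 0 0 - cx e - sh e * (c 0 1 - cy e)) / hw e.
pose V := (c 0 1 - cy e) / hh e.
have hE s : gauge2 e (2 * c 0 0 - (cx e + s * (sh e * hh e))) (2 * c 0 1 - (cy e + s * hh e)) =
    (2 * U) ^+ 2 + (2 * V - s) ^+ 2.
  by rewrite /gauge2 /U /V; field; rewrite ?w0 ?h0.
have h1 := h 1 (expr1n _ 2).
have h2 : gauge2 e (2 * c 0 0 - (cx e + -1 * (sh e * hh e))) (2 * c 0 1 - (cy e + -1 * hh e)) <= 1.
  by apply: h; rewrite sqrrN expr1n.
rewrite !hE in h1 h2.
have UV : U ^+ 2 + V ^+ 2 <= 0 by nra.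
have := sqr_ge0 U; have := sqr_ge0 V => V0 U0.
have /eqP : V ^+ 2 = 0 by lra.
have /eqP : U ^+ 2 = 0 by lra.
rewrite !sqrf_eq0 !mulf_eq0 !invr_eq0 (negPf w0) (negPf h0) !orbF => /eqP a /eqP b.
by apply: vecP; rewrite ?vec0 ?vec1; [move: a; rewrite b mulr0|]; lra.
Qed.

Lemma symmetry_center_region e : nondegenerate e -> symmetry_center (region e) = center e.
Proof.
move=> ne; apply: region_center_unique => //; rewrite /symmetry_center.
by apply: getPex; exists (center e); apply: region_symmetric.
Qed.

Lemma enlarge_region e lam v : nondegenerate e -> 1 < lam ->
  gauge2 e (v 0 0) (v 0 1) <= lam ^+ 2 -> enlarge lam (region e) v.
Proof.
move=> ne lam1 hv; rewrite /enlarge symmetry_center_region //.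
have l0 : 0 < lam by lra.
exists (lam^-1 *: (v - center e) + center e); last first.
  by rewrite addrK scalerA divff ?gt_eqF // scale1r subrK.
rewrite /region /= (_ : gauge2 _ _ _ = gauge2 e (v 0 0) (v 0 1) / lam ^+ 2).
  by rewrite ler_pdivrMr ?mul1r // exprn_gt0.
by rewrite /gauge2 !mxE /= -exprVn; ring.
Qed.

Lemma translate_region e v :
  translate (region e) v = region (affine_ellipse 1 1 (v 0 0) (v 0 1) e).
Proof.
have E x y : gauge2 (affine_ellipse 1 1 (v 0 0) (v 0 1) e) (x + v 0 0) (y + v 0 1) = gauge2 e x y.
  have := @gauge2_affine _ 1 1 (v 0 0) (v 0 1) e x y (oner_neq0 _) (oner_neq0 _).
  by rewrite !mul1r.
apply/seteqP; split=> [_ [w hw <-]|w hw].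
  by rewrite /region /= !mxE E.
exists (w - v); last by rewrite subrK.
by move: hw; rewrite /region /= !mxE -E !subrK.
Qed.

Lemma region_convex_body e : nondegenerate e -> is_symmetric_convex_body (region e).
Proof.
move=> ne; split.
- exact: region_compact.
- exact: region_convex.
- by exists (center e); apply: center_interior.
- by exists (center e); apply: region_symmetric.
Qed.
End Plane.

(** * One narrow column between two vertically neighbouring discs *)

Section Column.
Variable R : realType.
Implicit Types (lam x y : R).

Definition in_column (n k : nat) x : Prop :=
  -1 + 2 * (k%:R / n%:R) < x < -1 + 2 * (k.+1%:R / n%:R).

(** The rectangle to be packed is p < x < q, u < y < 4 - u. The height u lies above the unit disc
    throughout the column, and u + [tau] is still within the enlarged disc. *)
Lemma fill_column lam (n k : nat) : 1 < lam -> (4 <= n)%N -> (k < n)%N ->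
  16 <= (lam ^+ 2 - 1) * n%:R ->
  exists S : set (ellipse R),
    packs S (fun x y => in_column n k x /\
      [/\ -1 < x < 1, 0 < y < 4, 1 <= x ^+ 2 + y ^+ 2 & 1 <= x ^+ 2 + (4 - y) ^+ 2]) /\
    forall x y, -1 + 2 * (k%:R / n%:R) <= x <= -1 + 2 * (k.+1%:R / n%:R) -> 0 <= y <= 4 ->
    [\/ x ^+ 2 + y ^+ 2 <= lam ^+ 2, x ^+ 2 + (4 - y) ^+ 2 <= lam ^+ 2 | covers lam S x y].
Proof.
move=> lam1 n4 kn hn.
have n4' : 4 <= n%:R :> R by rewrite (ler_nat R 4 n).
have n0 : 0 < n%:R :> R by lra.
have kn' : k%:R + 1 <= n%:R :> R by rewrite natr1 ler_nat.
have k0 : 0 <= k%:R :> R by [].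
pose w : R := n%:R^-1.
have w0 : 0 < w by rewrite invr_gt0.
have wn : w * n%:R = 1 by rewrite mulVf // gt_eqF.
have w4 : 4 * w <= 1 by nra.
pose p : R := -1 + 2 * (k%:R / n%:R); pose q : R := -1 + 2 * (k.+1%:R / n%:R).
have qE : q = p + 2 * w by rewrite /q /p -natr1 /w; ring.
have kw : k%:R * w <= 1 - w by nra.
have kw0 : 0 <= k%:R * w by rewrite mulr_ge0 // ltW.
have pE : p = -1 + 2 * (k%:R * w) by [].
have colE x : p < x < q -> in_column n k x by [].
rewrite -/p -/q; clearbody p q.
have p1 : -1 <= p by lra.
have q1 : q <= 1 by lra.
(* The term 4w bounds the variation of x^2 over the column, whose width is 2w. *)
pose u := Num.sqrt (1 - p ^+ 2 + 4 * w).
have u0 : 0 <= u by apply: sqrtr_ge0.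
have u2 : u ^+ 2 = 1 - p ^+ 2 + 4 * w by rewrite sqr_sqrtr //; nra.
have ult : u < 3 / 2 by nra.
clearbody u.
(* Up to height u + [tau], x^2 + y^2 is at most 1 + 8 w + 2 u tau + tau^2, which for tau = w / 4
   stays below 1 + 16 w. *)
have lw : 16 * w <= lam ^+ 2 - 1 by nra.
have bnd x : p <= x <= q -> - (4 * w) <= x ^+ 2 - p ^+ 2 <= 4 * w.
  by move=> /andP[? ?]; apply/andP; split; nra.
pose tau := w / 4.
have tau0 : 0 < tau by rewrite /tau; lra.
have [S [PS CS]] := @fill_rect R lam p q u (4 - u) tau lam1 ltac:(lra) ltac:(lra) tau0.
exists S; split.
  apply: packsW PS => x y [/andP[x1 x2] /andP[y1 y2]]; split; first by apply: colE; rewrite x1.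
  have /andP[b1 b2] := bnd x (introT andP (conj (ltW x1) (ltW x2))).
  split; [by lra|by lra| |].
    by nra.
  by nra.
move=> x y hx hy.
have /andP[b1 b2] := bnd x hx.
have [y1|y1] := leP y (u + tau).
  by apply: Or31; rewrite /tau in y1 *; nra.
have [y2|y2] := leP (4 - u - tau) y.
  by apply: Or32; rewrite /tau in y2 *; nra.
by apply: Or33; apply: CS => //; rewrite !ltW.
Qed.
End Column.

(** * The cell of the lattice, its translates, and the periodic packing *)

Section Lattice.
Variable R : realType.
Implicit Types (lam x y : R).

Lemma in_column_inj (n k k' : nat) x : (0 < n)%N ->
  in_column n k x -> in_column n k' x -> k = k'.
Proof.
move=> n0; suff le (i j : nat) : in_column n i x -> in_column n j x -> (i <= j)%N.
  by move=> h h'; apply/eqP; rewrite eqn_leq !le.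
move=> /andP[h _] /andP[_ h']; have := lt_trans h h'.
by rewrite ltrD2l ltr_pM2l // ltr_pM2r ?invr_gt0 ?ltr0n // ltr_nat.
Qed.

Lemma int_eq_of_dist (i j : int) (d : R) : 0 < d ->
  d * (i%:~R - j%:~R) < d -> - d < d * (i%:~R - j%:~R) -> i = j.
Proof.
move=> d0 h1 h2.
have {}h1 : (i - j)%:~R < 1%:~R :> R by rewrite rmorphB -(ltr_pM2l d0) mulr1.
have {}h2 : (-1)%:~R < (i - j)%:~R :> R by rewrite rmorphB -(ltr_pM2l d0) mulrN1.
by move: h1 h2; rewrite !ltr_int; lia.
Qed.

Definition unit_ellipse : ellipse R := Ellipse 0 0 0 1 1.

Lemma gauge2_unit x y : gauge2 unit_ellipse x y = x ^+ 2 + y ^+ 2.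
Proof. by rewrite /gauge2 /= !divr1 !subr0 mul0r subr0. Qed.

(** The open disc around the origin together with the gap above it, up to the disc around (0, 4).
    The disc reaches below y = 0, so the cell is not a rectangle. *)
Definition cell (x y : R) : Prop :=
  x ^+ 2 + y ^+ 2 < 1 \/
  [/\ -1 < x < 1, 0 < y < 4, 1 <= x ^+ 2 + y ^+ 2 & 1 <= x ^+ 2 + (4 - y) ^+ 2].

(** The second alternative stands for the disc around (0, 4), which belongs to the next cell
    above. *)
Lemma fill_cell lam : 1 < lam ->
  exists S : set (ellipse R), packs S cell /\
    forall x y, -1 <= x < 1 -> 0 <= y <= 4 ->
      covers lam S x y \/ covers lam S x (y - 4).
Proof.
move=> lam1.
have lam2 : 0 < lam ^+ 2 - 1 by nra.
pose n := maxn 4 (Num.bound (16 / (lam ^+ 2 - 1))).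
have n4 : (4 <= n)%N by apply: leq_maxl.
have n0 : (0 < n)%N by apply: leq_trans n4.
have n0' : 0 < n%:R :> R by rewrite ltr0n.
have hn : 16 <= (lam ^+ 2 - 1) * n%:R.
  rewrite mulrC -ler_pdivrMr //.
  apply: (@le_trans _ _ (Num.bound (16 / (lam ^+ 2 - 1)))%:R); last by rewrite ler_nat leq_maxr.
  by rewrite ltW // archi_boundP // divr_ge0 // ltW.
have /choice [S HS] := fun k : 'I_n => fill_column lam1 n4 (ltn_ord k) hn.
pose S0 := \bigcup_k S k.
have PS0 : packs S0 _ := packs_bigcup (fun k => (HS k).1)
  (fun i j x y h h' => val_inj (in_column_inj n0 h.1 h'.1)).
exists ([set unit_ellipse] `|` S0); split.
  have PU : packs [set unit_ellipse] (fun x y => gauge2 unit_ellipse x y < 1).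
    by apply: packs_set1; apply: oner_neq0.
  apply: packsW (packs_setU PU PS0 _).
    by move=> x y [|[k [_ h]]]; [rewrite gauge2_unit; left|right].
  move=> x y; rewrite gauge2_unit => h [k [_ [_ _ h' _]]].
  by have := lt_le_trans h h'; rewrite ltxx.
move=> x y /andP[x0 x1] hy.
have t0 : 0 <= (x + 1) / 2 * n%:R by rewrite mulr_ge0 // divr_ge0 //; lra.
have /andP[k1 k2] := truncn_itv t0.
(* The column index is below n because x < 1 is strict. *)
have kn : (Num.trunc ((x + 1) / 2 * n%:R) < n)%N.
  rewrite -(ltr_nat R); apply: (le_lt_trans k1).
  by rewrite -[X in _ < X]mul1r ltr_pM2r //; lra.
move: k1 k2; rewrite -ler_pdivrMr // -ltr_pdivlMr // => k1 k2.
have [|h|h|[e eS h]] := (HS (Ordinal kn)).2 x y _ hy.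
- by rewrite /=; clear -k1 k2; apply/andP; split; lra.
- left; exists unit_ellipse; [by left|by rewrite gauge2_unit].
- right; exists unit_ellipse; [by left|rewrite gauge2_unit].
  by rewrite -[y - 4]opprB sqrrN.
- by left; exists e => //; right; exists (Ordinal kn).
Qed.

Definition lattice_union (S : set (ellipse R)) : set (ellipse R) :=
  \bigcup_(ij : int * int) (affine_ellipse 1 1 (2 * ij.1%:~R) (4 * ij.2%:~R) @` S).

(** Widths below 2 force i = i'. A cell has heights between -1 and 4, so the only possible overlap
    with a cell above is that of a gap with the disc on top of it, which the last condition of
    [cell] rules out. *)
Lemma cell_disjoint (i i' j j' : int) x y :
  cell (x - 2 * i%:~R) (y - 4 * j%:~R) -> cell (x - 2 * i'%:~R) (y - 4 * j'%:~R) ->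
  (i, j) = (i', j').
Proof.
have rng (a b : R) : cell a b -> -1 < a < 1 /\ -1 < b < 4.
  move=> [h|[-> /andP[b0 b4] _ _]].
    by split; apply/andP; split; nra.
  by split=> //; apply/andP; split; lra.
move=> h h'; have [/andP[a1 a2] _] := rng _ _ h; have [/andP[a1' a2'] _] := rng _ _ h'.
have ii : i = i' by apply: (@int_eq_of_dist _ _ 2) => //; lra.
rewrite -{}ii {a1 a2 a1' a2'} in h' *.
have low (k k' : int) : cell (x - 2 * i%:~R) (y - 4 * k%:~R) ->
    cell (x - 2 * i%:~R) (y - 4 * k'%:~R) -> (k < k')%R -> False.
  move=> hk hk' kk'.
  have {}kk' : k%:~R + 1 <= k'%:~R :> R.
    by rewrite -[1]/(1%:~R) -rmorphD ler_int; lia.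
  have [_ /andP[b1 b2]] := rng _ _ hk; have [_ /andP[b1' b2']] := rng _ _ hk'.
  move: hk hk' b1 b2 b1' b2'; set a := x - _ => hk hk'.
  have [c [cE c4]] : exists c : R, y - 4 * k'%:~R = c /\ c + 4 <= y - 4 * k%:~R.
    by exists (y - 4 * k'%:~R); split=> //; lra.
  move: hk hk'; rewrite cE; move: (y - 4 * k%:~R) c4 => b c4 hk hk' b1 b2 b1' b2'.
  case: hk => [h1|[_ /andP[_ b4] _ h1]]; first by nra.
  case: hk' => [h2|[_ /andP[c0 _] _ _]]; last by lra.
  by nra.
congr (_, _); apply/eqP; case: ltgtP => // kk; [case: (low j j')|case: (low j' j)] => //.
Qed.

Lemma packs_lattice S : packs S cell ->
  packs (lattice_union S) (fun x y => exists ij : int * int,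
    cell ((x - 2 * ij.1%:~R) / 1) ((y - 4 * ij.2%:~R) / 1)).
Proof.
move=> PS; apply: packs_bigcup => [ij|[i j] [i' j'] x y /=].
  by apply: packs_affine PS; apply: oner_neq0.
by rewrite !divr1; apply: cell_disjoint.
Qed.

Lemma covers_lattice lam S :
  (forall x y, -1 <= x < 1 -> 0 <= y <= 4 ->
     covers lam S x y \/ covers lam S x (y - 4)) ->
  forall x y, covers lam (lattice_union S) x y.
Proof.
move=> CS x y.
pose i := Num.floor ((x + 1) / 2); pose j := Num.floor (y / 4).
have /andP[i1 i2] := floor_itv ((x + 1) / 2).
have /andP[j1 j2] := floor_itv (y / 4).
rewrite -/i rmorphD /= in i1 i2; rewrite -/j rmorphD /= in j1 j2.
have shift (k : int) : covers lam S (x - 2 * i%:~R) (y - 4 * k%:~R) ->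
    covers lam (lattice_union S) x y.
  move=> h; apply: (@covers_sub _ _ (affine_ellipse 1 1 (2 * i%:~R) (4 * k%:~R) @` S)).
    by move=> e he; exists (i, k).
  by apply: covers_affine; rewrite ?oner_neq0 // !divr1.
have [||h|h] := CS (x - 2 * i%:~R) (y - 4 * j%:~R).
- by apply/andP; split; lra.
- by apply/andP; split; lra.
- exact: shift h.
(* The disc on top of the gap belongs to the cell with vertical index j + 1. *)
- apply: (shift (j + 1)); rewrite rmorphD /= mulrDr mulr1.
  by rewrite opprD addrA.
Qed.

Lemma lattice_union_shift S e (a b : int) : lattice_union S e ->
  lattice_union S (affine_ellipse 1 1 (2 * a%:~R) (4 * b%:~R) e).
Proof.
move=> [[i j] _ [e0 Se0 <-]]; exists (i + a, j + b) => //; exists e0 => //.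
by rewrite /affine_ellipse /= !rmorphD /= !divr1 !mul1r; congr Ellipse; ring.
Qed.

Lemma region_family_packing (E : set (ellipse R)) D :
  packs E D -> is_packing [set region e | e in E].
Proof.
move=> [P _ I]; split=> [_ [e Ee <-]|]; first by apply: region_convex_body; apply: P.
move=> _ _ [e Ee <-] [e' Ee' <-] [v [hv hv']].
by rewrite (I e e' (v 0 0) (v 0 1)) //; apply: interior_region.
Qed.

Lemma lattice_union_periodic S : is_periodic [set region e | e in lattice_union S].
Proof.
exists (vec 2 0), (vec 0 4); split.
  rewrite free_cons seq1_free; apply/andP; split.
    rewrite span_seq1; apply/vlineP => -[k /matrixP/(_ 0 0)].
    by rewrite !mxE /= mulr0 => /eqP; rewrite pnatr_eq0.
  by apply/eqP => /matrixP/(_ 0 1); rewrite !mxE /= => /eqP; rewrite pnatr_eq0.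
have key (a b : int) (v : 'rV[R]_2) e : v 0 0 = 2 * a%:~R -> v 0 1 = 4 * b%:~R -> lattice_union S e ->
    [set region e | e in lattice_union S] (translate (region e) v).
  move=> va vb he; rewrite translate_region va vb; eexists; last by [].
  exact: lattice_union_shift.
move=> _ [e he <-]; split.
- by apply: (key 1 0); rewrite ?mxE /= ?mulr0z ?mulr1 ?mulr0.
- by apply: (key (-1) 0); rewrite ?mxE /= ?mulr0z ?mulrN1 ?mulr0 ?oppr0.
- by apply: (key 0 1); rewrite ?mxE /= ?mulr0z ?mulr1 ?mulr0.
- by apply: (key 0 (-1)); rewrite ?mxE /= ?mulr0z ?mulrN1 ?mulr0 ?oppr0.
Qed.
End Lattice.

Theorem theorem1 (R : realType) (lambda : R) (hlambda : 1 < lambda) :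
  exists CC : set (set 'rV[R]_2),
    [/\ is_packing CC,
        forall C, CC C -> is_ellipse C,
        is_periodic CC &
        is_covering (enlargement lambda CC)].
Proof.
have [S [PS CS]] := fill_cell hlambda.
have PE := packs_lattice PS; have [NE _ _] := PE.
exists [set region e | e in lattice_union S]; split.
- exact: region_family_packing PE.
- by move=> _ [e /NE ne <-]; apply: region_is_ellipse.
- exact: lattice_union_periodic.
- apply/seteqP; split=> // v _.
  have [e he hv] := covers_lattice CS (v 0 0) (v 0 1).
  exists (enlarge lambda (region e)); first by exists (region e) => //; exists e.
  by apply: enlarge_region => //; apply: NE.
Qed.
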